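(* Let $S_n(\mathbb{C})$ denote the set of complex symmetric $n\times n$ matrices and let $\Phi: S_n(\mathbb{C}) \to M_r(\mathbb{C})$ be a complex linear map preserving zero products (i.e. $\Phi(A)\Phi(B)=0$ whenever $A,B\in S_n(\mathbb{C})$ with $AB=0$). Then: (i) $\Phi(A)$ is an idempotent for every rank one idempotent $A$ in $S_n(\mathbb{R})$ if and only if there exist a nonnegative integer $k$ with $kn\le r$ and an invertible $S\in M_r(\mathbb{C})$ such that $\Phi(A) = S^{-1}\begin{pmatrix} I_k\otimes A & 0\\ 0 & 0_{r-kn}\end{pmatrix}S$ for all $A\in S_n(\mathbb{C})$; (ii) $\Phi(A)$ is a symmetric idempotent for every rank one idempotent $A$ in $S_n(\mathbb{R})$ if and only if the representation in (i) holds with $S$ complex orthogonal ($S^{-1}=S^{\mathrm t}$).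
   Context: $S_n(\mathbb{R})$ denotes the real symmetric $n\times n$ matrices; $I_k\otimes A$ denotes $A\oplus\cdots\oplus A$ ($k$ copies); $S^{\mathrm t}$ is the transpose. *)

(* Defs.v *)
(* The complex field C is modelled by an arbitrary
   numClosedFieldType (e.g. algC); "real" entries are those in Num.real. *)
From HB Require Import structures.
From mathcomp Require Import all_boot all_order all_algebra.
Set Implicit Arguments. Unset Strict Implicit. Unset Printing Implicit Defensive.
Import Order.TTheory GRing.Theory Num.Theory.
Local Open Scope ring_scope.

Definition symmx {C : numClosedFieldType} {n : nat} (A : 'M[C]_n) : Prop :=
  A^T = A.

Definition rank1_real_sym_idem {C : numClosedFieldType} {n : nat}
  (A : 'M[C]_n) : Prop :=
  [/\ A^T = A, A \is a mxOver Num.real, A *m A = A & \rank A = 1%N].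

Definition linear_on_sym {C : numClosedFieldType} {n r : nat}
  (Phi : 'M[C]_n -> 'M[C]_r) : Prop :=
  forall (a : C) (A B : 'M[C]_n), symmx A -> symmx B ->
    Phi (a *: A + B) = a *: Phi A + Phi B.

Definition zero_prod_pres {C : numClosedFieldType} {n r : nat}
  (Phi : 'M[C]_n -> 'M[C]_r) : Prop :=
  forall A B : 'M[C]_n, symmx A -> symmx B -> A *m B = 0 ->
    Phi A *m Phi B = 0.

Definition mxentry {C : numClosedFieldType} {n : nat} (A : 'M[C]_n)
  (i j : nat) : C :=
  match (insub i : option 'I_n), (insub j : option 'I_n) with
  | Some i', Some j' => A i' j'
  | _, _ => 0
  end.

(* the r x r matrix  diag(I_k (x) A, 0_{r-kn}), i.e. k diagonal copies of A
   in the top-left kn x kn block and zeros elsewhere (entrywise form) *)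
Definition kron_block {C : numClosedFieldType} {n : nat} (r k : nat)
  (A : 'M[C]_n) : 'M[C]_r :=
  \matrix_(i < r, j < r)
    if [&& (i < k * n)%N, (j < k * n)%N & (i %/ n == j %/ n)%N]
    then mxentry A (i %% n) (j %% n) else 0.

(* Main.v *)
(* A zero product preserving Phi sends P_i = Phi(E_ii) and
   H_ij = Phi(E_ij + E_ji) to elements subject to relations coming from
   orthogonal vectors v, w, since (v v^T)(w w^T) = 0 when v^T w = 0.  Together
   with idempotency on rank one projections these make e_ij = P_i H_ij a system
   of n x n matrix units such that Phi(A) = sum_ij A_ij e_ij.  Splitting
   e_00 = X Y with Y X = I_k, the columns of the e_i0 X and the rows of the
   Y e_0j are dual bases that put Phi in block form; a splitting of the
   complementary idempotent completes them to S^-1 and S.  For (ii) the e_ij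
   satisfy e_ij^T = e_ji, and symmetric idempotents split as X X^T with
   X^T X = I because C has square roots, so that S becomes orthogonal. *)
Require Import Defs.
From HB Require Import structures.
From mathcomp Require Import all_boot all_order all_algebra.
From mathcomp Require Import ring.
Import Order.TTheory GRing.Theory Num.Theory.
Local Open Scope ring_scope.

(** * Splitting idempotents *)

Section Splitting.
Variable C : numClosedFieldType.

(** In a rank factorization, idempotency reads [X (Y X) Y = X Y]; [X] cancels on the left and [Y] on
    the right. *)
Lemma idem_split r (P : 'M[C]_r) : P *m P = P ->
  exists k (X : 'M[C]_(r, k)) (Y : 'M[C]_(k, r)), P = X *m Y /\ Y *m X = 1%:M.
Proof.
move=> PP; have := (mulmx_base P, col_base_full P, row_base_free P).
move: (col_base P) (row_base P) => X Y [[XY fullX] freeY].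
exists (\rank P), X, Y; split=> //.
apply/(row_full_inj fullX)/(row_free_inj freeY).
by rewrite /= mulmx1 mulmxA XY -mulmxA XY PP.
Qed.

(** Polarization for the bilinear form [u^T P v], without conjugation: its values on the vectors
    [e_i + e_j] determine [P]. *)
Lemma sym_form_neq0 r (P : 'M[C]_r) : P^T = P -> P != 0 ->
  exists v : 'cV[C]_r, v^T *m P *m v != 0.
Proof.
move=> sP nzP.
pose q (u v : 'cV[C]_r) := (u^T *m P *m v) 0 0.
have qC u v : q u v = q v u.
  rewrite /q -[in RHS](trmxK (v^T *m P *m u)) [in RHS]mxE.
  by rewrite !trmx_mul sP trmxK mulmxA.
have qe i j : q (delta_mx i 0) (delta_mx j 0) = P i j.
  by rewrite /q trmx_delta -rowE -colE !mxE.
have qDl u v w : q (u + v) w = q u w + q v w.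
  by rewrite /q linearD /= !mulmxDl mxE.
have qDr u v w : q u (v + w) = q u v + q u w by rewrite qC qDl !(qC _ u).
have [/existsP[i /existsP[j nz]]|/existsPn h] :=
  boolP [exists i, exists j, q (delta_mx i 0 + delta_mx j 0)
                              (delta_mx i 0 + delta_mx j 0) != 0].
  exists (delta_mx i 0 + delta_mx j 0); apply: contraNneq nz => z.
  by rewrite /q z mxE.
case/eqP: nzP; apply/matrixP=> i j; rewrite mxE.
have {}h k l : P k k + P l l + P k l *+ 2 = 0.
  have /existsPn/(_ l)/negPn/eqP := h k.
  by rewrite qDl !qDr (qC (delta_mx l 0) (delta_mx k 0)) !qe => <-; ring.
(* The case [k = l] of [h] reads [4 P k k = 0]. *)
have d k : P k k = 0.
  by rewrite -(mul0r 4^-1) -{1}(h k k); field.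
by have /eqP := h i j; rewrite !d !add0r mulrn_eq0 => /eqP.
Qed.

(** Gram-Schmidt for the bilinear form, by induction on the rank. Isotropic vectors are avoided by
    choosing [u] with [(P u)^T (P u) = u^T P u] nonzero; a square root then normalizes [P u]. *)
Lemma sym_idem_split r (P : 'M[C]_r) : P^T = P -> P *m P = P ->
  exists k (X : 'M[C]_(r, k)), P = X *m X^T /\ X^T *m X = 1%:M.
Proof.
have [m] := ubnP (\rank P); elim: m P => // m IH P; rewrite ltnS => rP sP PP.
have [->|nzP] := eqVneq P 0.
  by exists 0%N, 0; split; [rewrite mul0mx | by apply/matrixP=> [[]]].
have [u nz] := sym_form_neq0 _ _ sP nzP.
pose c := (u^T *m P *m u) 0 0.
have nzc : sqrtC c != 0.
  rewrite sqrtC_eq0; apply: contraNneq nz => z.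
  by rewrite [u^T *m P *m u]mx11_scalar -/c z raddf0.
(* Split off the unit vector [v] of the range of [P]. *)
pose v := (sqrtC c)^-1 *: (P *m u).
have Pv : P *m v = v by rewrite /v -scalemxAr mulmxA PP.
have vP : v^T *m P = v^T by rewrite -{1}sP -trmx_mul Pv.
have vv : v^T *m v = 1%:M.
  rewrite {2}/v -scalemxAr mulmxA vP /v linearZ /= trmx_mul sP -scalemxAl.
  rewrite scalerA [_ *m u]mx11_scalar -/c scale_scalar_mx -expr2 exprVn sqrtCK.
  by rewrite mulVf // -sqrtC_eq0.
pose P' := P - v *m v^T.
have vP' : v^T *m P' = 0 by rewrite mulmxBr vP mulmxA vv mul1mx subrr.
have P'v : P' *m v = 0 by rewrite mulmxBl Pv -mulmxA vv mulmx1 subrr.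
have sP' : P'^T = P' by rewrite linearB /= sP trmx_mul trmxK.
have P'P' : P' *m P' = P'.
  by rewrite {1}/P' mulmxBl -mulmxA vP' mulmx0 subr0 mulmxBr PP mulmxA Pv.
have nzv : v^T != 0.
  apply: contra_eq_neq vv => ->; rewrite mul0mx eq_sym.
  by apply/eqP => /matrixP/(_ 0 0)/eqP; rewrite !mxE oner_eq0.
(* The row space of [P] contains [v^T], while [v^T = w P'] would give
   [v^T = w P' P' = v^T P' = 0]. *)
have ltP : (P' < P)%MS.
  rewrite ltmxE; apply/andP; split.
    by rewrite /P' -vP mulmxA -{1}(mul1mx P) -mulmxBl submxMl.
  apply: contra nzv => PP'.
  have /submxP[w vw] : (v^T <= P')%MS by rewrite -vP (submx_trans (submxMl _ _)).
  by rewrite vw -P'P' mulmxA -vw vP'.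
have [|k [X [PX XX]]] := IH P' _ sP' P'P'.
  exact: leq_trans (rank_ltmx ltP) rP.
have Xv : X^T *m v = 0.
  by rewrite -[X^T]mul1mx -XX -!mulmxA (mulmxA X) -PX P'v mulmx0.
have vX : v^T *m X = 0 by rewrite -[X]trmxK -trmx_mul Xv trmx0.
exists (1 + k)%N, (row_mx v X); rewrite tr_row_mx mul_row_col -PX; split.
  by rewrite addrC subrK.
by rewrite mul_col_row vv XX Xv vX -scalar_mx_block.
Qed.

(** [S] stacks [V] over [U] and [T] puts [W] beside [Z], so that [T S = W V + Z U]. The last clause
    serves the orthogonal case. *)
Lemma basis_completion r m s (W : 'M[C]_(r, m)) (Z : 'M[C]_(r, s))
    (V : 'M[C]_(m, r)) (U : 'M[C]_(s, r)) :
    V *m W = 1%:M -> U *m Z = 1%:M -> W *m V + Z *m U = 1%:M ->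
  exists (le_mr : (m <= r)%N) (S T : 'M[C]_r),
    [/\ T *m S = 1%:M, rowsub (widen_ord le_mr) S = V,
        colsub (widen_ord le_mr) T = W
      & V = W^T -> U = Z^T -> T = S^T].
Proof.
move=> VW UZ WVZU.
(* Traces give [r = m + s] since the characteristic is zero. *)
have Dr : r = (m + s)%N.
  apply/eqP; rewrite -(eqr_nat C) -mxtrace1 -WVZU linearD /=.
  by rewrite mxtrace_mulC VW mxtrace_mulC UZ !mxtrace1 natrD.
subst r; have le_mr := leq_addr s m.
have Ew : widen_ord le_mr =1 lshift s by move=> i; apply: val_inj.
exists le_mr, (col_mx V U), (row_mx W Z); split=> [|||-> ->].
- by rewrite mul_row_col.
- by apply/matrixP=> i j; rewrite mxE Ew col_mxEu.
- by apply/matrixP=> i j; rewrite mxE Ew row_mxEl.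
- by rewrite tr_col_mx !trmxK.
Qed.

End Splitting.

(** * The block matrices [I_k (x) A] *)

Section KronBlock.
Variables (C : numClosedFieldType) (n r k : nat).
Hypothesis le_kn_r : (k * n <= r)%N.

Lemma block_index_proof (a : 'I_k) (p : 'I_n) : (a * n + p < k * n)%N.
Proof.
by rewrite (@leq_trans (a.+1 * n)%N) ?leq_mul // mulSnr ltn_add2l.
Qed.

Definition block_index a p := Ordinal (block_index_proof a p).

Lemma block_index_div a p : (block_index a p %/ n = a)%N.
Proof. by rewrite /= divnMDl ?(leq_ltn_trans _ (ltn_ord p)) // divn_small ?addn0. Qed.

Lemma block_index_mod a p : (block_index a p %% n = p)%N.
Proof. by rewrite /= modnMDl modn_small. Qed.

Lemma block_indexP (c : 'I_(k * n)) : exists a p, c = block_index a p.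
Proof.
have n0 : (0 < n)%N by case: n c => // -[m]; rewrite muln0.
have h1 : (c %/ n < k)%N by rewrite ltn_divLR.
exists (Ordinal h1), (Ordinal (ltn_pmod c n0)); apply: val_inj.
exact: divn_eq.
Qed.

Lemma block_index_eq a b p q :
  (block_index a p == block_index b q) = (a == b) && (p == q).
Proof.
apply/eqP/andP=> [E|[/eqP-> /eqP->]] //; split; apply/eqP/val_inj.
  by rewrite /= -(block_index_div a p) E block_index_div.
by rewrite /= -(block_index_mod a p) E block_index_mod.
Qed.

(** Avoids an explicit inverse of [block_index]: the sum has a single surviving term. *)
Lemma block_index_fun (T : nmodType) (f : 'I_k -> 'I_n -> T) :
  exists g : 'I_(k * n) -> T, forall a p, g (block_index a p) = f a p.
Proof.
exists (fun c => \sum_a \sum_p if block_index a p == c then f a p else 0) => a p.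
rewrite (bigD1 a) //= [X in _ + X]big1 ?addr0 => [|b /negPf ne].
  rewrite (bigD1 p) //= eqxx big1 ?addr0 // => q /negPf ne.
  by rewrite block_index_eq ne andbF.
by apply: big1 => q _; rewrite block_index_eq ne.
Qed.

(** Inclusion of [C^n] into [C^r] as the block [a] of coordinates. *)
Definition block_incl (a : 'I_k) : 'M[C]_(r, n) :=
  \matrix_(i, p) (i == widen_ord le_kn_r (block_index a p))%:R.

Lemma block_incl_mull m (a : 'I_k) (M : 'M[C]_(r, m)) p j :
  ((block_incl a)^T *m M) p j = M (widen_ord le_kn_r (block_index a p)) j.
Proof.
rewrite mxE (bigD1 (widen_ord le_kn_r (block_index a p))) //= !mxE eqxx mul1r.
by rewrite big1 ?addr0 // => i /negPf ne; rewrite !mxE ne mul0r.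
Qed.

Lemma block_incl_mulr m (a : 'I_k) (M : 'M[C]_(m, r)) i p :
  (M *m block_incl a) i p = M i (widen_ord le_kn_r (block_index a p)).
Proof.
by rewrite -[_ *m _]trmxK trmx_mul mxE -{1}[block_incl a]trmxK trmxK
           block_incl_mull mxE.
Qed.

Lemma block_incl_ortho a b :
  (block_incl a)^T *m block_incl b = (a == b)%:R%:M.
Proof.
apply/matrixP=> p q; rewrite block_incl_mull !mxE.
rewrite -(inj_eq val_inj) /= -[_ == _ :> nat]/(block_index a p == block_index b q).
by rewrite block_index_eq; case: eqP; case: eqP.
Qed.

Lemma mxentryE (A : 'M[C]_n) (p q : 'I_n) : mxentry A p q = A p q.
Proof. by rewrite /mxentry !valK. Qed.

(** Trades quotients and remainders for matrix products, so that multiplicativity and transposition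
    become formal. *)
Lemma kron_blockE (A : 'M[C]_n) :
  kron_block r k A = \sum_a block_incl a *m A *m (block_incl a)^T.
Proof.
have E0 (i : 'I_r) a q : (k * n <= i)%N -> (block_incl a *m A) i q = 0.
  move=> le; rewrite mxE big1 // => p _; rewrite mxE.
  by rewrite -(inj_eq val_inj) /= gtn_eqF ?mul0r // (leq_trans (ltn_ord (block_index a p))).
have E1 b p a q :
    (block_incl a *m A) (widen_ord le_kn_r (block_index b p)) q = (a == b)%:R * A p q.
  by rewrite -block_incl_mull mulmxA block_incl_ortho mul_scalar_mx mxE eq_sym.
apply/matrixP=> i j; rewrite mxE summxE.
have [lei|lti] /= := leqP (k * n)%N i.
  by rewrite big1 // => a _; rewrite mxE big1 // => q _; rewrite E0 // mul0r.
have [a [p Di]] := block_indexP (Ordinal lti).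
have {}Di : i = widen_ord le_kn_r (block_index a p).
  by apply: val_inj; have /(congr1 val) := Di.
rewrite (bigD1 a) //= big1 ?addr0 => [|b /negPf ne]; last first.
  by rewrite mxE big1 // => q _; rewrite Di E1 ne !mul0r.
have [lej|ltj] /= := leqP (k * n)%N j.
  rewrite mxE big1 // => q _; rewrite !mxE -(inj_eq val_inj) /=.
  by rewrite gtn_eqF ?mulr0 // (leq_trans (ltn_ord (block_index a q))).
have [b [q Dj]] := block_indexP (Ordinal ltj).
have {}Dj : j = widen_ord le_kn_r (block_index b q).
  by apply: val_inj; have /(congr1 val) := Dj.
rewrite Dj -block_incl_mulr -mulmxA block_incl_ortho mul_mx_scalar mxE Di E1 eqxx mul1r.
rewrite (block_index_div a) (block_index_div b) (block_index_mod a) (block_index_mod b).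
rewrite mxentryE (inj_eq val_inj).
by case: eqP; rewrite ?mul1r ?mul0r.
Qed.

Lemma kron_blockM (A B : 'M[C]_n) :
  kron_block r k A *m kron_block r k B = kron_block r k (A *m B).
Proof.
rewrite !kron_blockE mulmx_suml; apply: eq_bigr => a _.
rewrite mulmx_sumr (bigD1 a) //= big1 ?addr0 => [|b /negPf ne].
  by rewrite !mulmxA -(mulmxA (_ *m A)) block_incl_ortho eqxx mulmx1.
rewrite !mulmxA -(mulmxA (_ *m A)) block_incl_ortho eq_sym ne.
by rewrite raddf0 mulmx0 !mul0mx.
Qed.

Lemma tr_kron_block (A : 'M[C]_n) : (kron_block r k A)^T = kron_block r k A^T.
Proof.
rewrite !kron_blockE linear_sum /=; apply: eq_bigr => a _.
by rewrite !trmx_mul trmxK mulmxA.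
Qed.

End KronBlock.

(** * The matrix units attached to [Phi] *)

(** The values at [1] and [-1] add up to [2 y = 0]; the value at [2] minus twice that at [1] then
    leaves [6 z = 0]. *)
Lemma cubic_coef_eq0 (F : numFieldType) (m n : nat) (x y z : 'M[F]_(m, n)) :
  (forall a : F, a *: x + a ^+ 2 *: y + a ^+ 3 *: z = 0) ->
  [/\ x = 0, y = 0 & z = 0].
Proof.
move=> h.
have {}h i j : [/\ x i j = 0, y i j = 0 & z i j = 0].
  have {}h a : a * x i j + a ^+ 2 * y i j + a ^+ 3 * z i j = 0.
    by have /matrixP/(_ i j) := h a; rewrite !mxE.
  have y0 : y i j = 0 by rewrite -(mul0r 2^-1) -(addr0 0) -{1}(h 1) -(h (-1)); field.
  have z0 : z i j = 0.
    by rewrite -(mul0r 6^-1) -(subr0 0) -{1}(h 2) -(mulr0 2) -(h 1) y0; field.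
  by split=> //; rewrite -(h 1) y0 z0; ring.
by split; apply/matrixP=> i j; have [] := h i j; rewrite mxE.
Qed.

Section MatrixUnits.
Variables (C : numClosedFieldType) (n r : nat) (Phi : 'M[C]_n -> 'M[C]_r).
Hypotheses (Hlin : linear_on_sym Phi) (Hzp : zero_prod_pres Phi).
Hypothesis Hidem : forall A : 'M[C]_n, rank1_real_sym_idem A -> Phi A *m Phi A = Phi A.

Lemma symmx0 : symmx (0 : 'M[C]_n).
Proof. exact: trmx0. Qed.

Lemma symmxD (A B : 'M[C]_n) : symmx A -> symmx B -> symmx (A + B).
Proof. by rewrite /symmx linearD /= => -> ->. Qed.

Lemma symmxZ a (A : 'M[C]_n) : symmx A -> symmx (a *: A).
Proof. by rewrite /symmx linearZ /= => ->. Qed.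

Lemma Phi0 : Phi 0 = 0.
Proof.
have := Hlin 1 0 0 symmx0 symmx0.
by rewrite !scale1r addr0 -{1}[Phi 0]addr0 => /addrI.
Qed.

Lemma PhiD A B : symmx A -> symmx B -> Phi (A + B) = Phi A + Phi B.
Proof. by move=> sA sB; have := Hlin 1 A B sA sB; rewrite !scale1r. Qed.

Lemma PhiZ a A : symmx A -> Phi (a *: A) = a *: Phi A.
Proof. by move=> sA; have := Hlin a A 0 sA symmx0; rewrite Phi0 !addr0. Qed.

Lemma Phi_sum (I : finType) (F : I -> 'M[C]_n) :
  (forall i, symmx (F i)) -> Phi (\sum_i F i) = \sum_i Phi (F i).
Proof.
move=> sF.
suff [] : symmx (\sum_i F i) /\ Phi (\sum_i F i) = \sum_i Phi (F i) by [].
elim/big_rec2: _ => [|i y A _ [sA <-]]; first by split; [exact: symmx0|exact: Phi0].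
by split; [exact: symmxD | rewrite PhiD].
Qed.

Notation e_ i := (delta_mx i 0 : 'cV[C]_n).

(** Polarization of [v *m v^T]: on the diagonal it is twice that square, and on distinct basis
    vectors it is [E_ij + E_ji]. *)
Definition symprod (u v : 'cV[C]_n) := u *m v^T + v *m u^T.

Lemma symmx_symprod u v : symmx (symprod u v).
Proof. by rewrite /symmx linearD /= !trmx_mul !trmxK addrC. Qed.

Lemma symmx_sq (v : 'cV[C]_n) : symmx (v *m v^T).
Proof. by rewrite /symmx trmx_mul trmxK. Qed.

Lemma symprodDl u v w : symprod (u + v) w = symprod u w + symprod v w.
Proof. by rewrite /symprod mulmxDl linearD /= mulmxDr addrACA. Qed.

Lemma symprodZl a u v : symprod (a *: u) v = a *: symprod u v.
Proof. by rewrite /symprod linearZ /= -scalemxAl -scalemxAr scalerDr. Qed.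

Lemma symprodC u v : symprod u v = symprod v u.
Proof. exact: addrC. Qed.

Lemma dot_e i j : (e_ i)^T *m e_ j = if i == j then 1%:M else 0.
Proof.
rewrite trmx_delta mul_delta_mx_cond; case: eqP => _; last exact: mulr0n.
by apply/matrixP=> k l; rewrite !mxE !ord1.
Qed.

Lemma zero_prodl (v w w' : 'cV[C]_n) : v^T *m w = 0 -> v^T *m w' = 0 ->
  Phi (v *m v^T) *m Phi (symprod w w') = 0.
Proof.
move=> h h'; apply: Hzp; [exact: symmx_sq | exact: symmx_symprod|].
by rewrite mulmxDr !mulmxA -!(mulmxA v v^T) h h' mulmx0 !mul0mx addr0.
Qed.

Definition diag_im i := Phi (e_ i *m (e_ i)^T).
Definition offdiag_im i j := Phi (symprod (e_ i) (e_ j)).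
Local Notation P := diag_im.
Local Notation H := offdiag_im.

Lemma offdiag_imC i j : H i j = H j i.
Proof. by rewrite /H symprodC. Qed.

Lemma offdiag_imii i : H i i = P i + P i.
Proof. by rewrite /H /symprod PhiD //; apply: symmx_sq. Qed.

(** The scalar [a] carries the normalization [a v^T v = 1], so no square root is needed. *)
Lemma sq_rank1_real_idem (a : C) (v : 'cV[C]_n) :
  a \is Num.real -> v \is a mxOver Num.real -> v^T *m (a *: v) = 1%:M ->
  rank1_real_sym_idem (a *: (v *m v^T)).
Proof.
move=> ra rv vv; split.
- by rewrite linearZ /= symmx_sq.
- apply: mxOverZ => //; apply: mxOverM => //.
  by apply/mxOverP=> i j; rewrite mxE; apply/mxOverP.
- transitivity (a *: (v *m (a *: (v^T *m v)) *m v^T)).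
    by rewrite -scalemxAl -!scalemxAr -scalemxAl !mulmxA.
  by rewrite (scalemxAr a v^T) vv mulmx1.
- have nzv : v != 0.
    apply: contra_eq_neq vv => ->; rewrite scaler0 mulmx0 eq_sym.
    by apply/eqP => /matrixP/(_ 0 0)/eqP; rewrite !mxE oner_eq0.
  (* The rank is at most 1 because [v] is a single column. It is not 0 because the matrix fixes the
     nonzero vector [a *: v]. *)
  rewrite scalemxAl; apply/eqP; rewrite eqn_leq mulmx_max_rank lt0n mxrank_eq0.
  apply: contraTneq nzv => z; apply/negPn/eqP.
  have : a *: v *m v^T *m (a *: v) = 0 by rewrite z mul0mx.
  rewrite -mulmxA vv mulmx1 => /eqP; rewrite scaler_eq0 => /orP[/eqP a0|/eqP //].
  move: vv; rewrite a0 scale0r mulmx0 => /matrixP/(_ 0 0)/eqP.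
  by rewrite !mxE eq_sym oner_eq0.
Qed.

Lemma real_e i : e_ i \is a mxOver Num.real.
Proof. by apply/mxOverP=> k l; rewrite mxE realn. Qed.

Lemma rank1_diag i : rank1_real_sym_idem (e_ i *m (e_ i)^T).
Proof.
rewrite -[_ *m _]scale1r; apply: sq_rank1_real_idem; rewrite ?rpred1 ?real_e //.
by rewrite scale1r dot_e eqxx.
Qed.

(** These projections and those of [rank1_diag] are the only ones at which the assumptions on images
    of idempotents get evaluated. *)
Lemma rank1_offdiag i j : i != j ->
  rank1_real_sym_idem (2^-1 *: ((e_ i + e_ j) *m (e_ i + e_ j)^T)).
Proof.
move=> /negPf ne; apply: sq_rank1_real_idem; rewrite ?rpredV ?realn //.
  by apply/mxOverP=> k l; rewrite mxE rpredD // mxE realn.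
rewrite -scalemxAr [(_ + _)^T]linearD /= mulmxDl !mulmxDr !dot_e !eqxx ne eq_sym ne.
rewrite addr0 add0r -raddfD /= scale_scalar_mx; congr (_%:M).
by rewrite mulVf // pnatr_eq0.
Qed.

(** * Relations between the diagonal and off-diagonal images *)

Lemma sq_eDZ i j (a : C) :
  (e_ i + a *: e_ j) *m (e_ i + a *: e_ j)^T =
  e_ i *m (e_ i)^T + a *: symprod (e_ i) (e_ j) + a ^+ 2 *: (e_ j *m (e_ j)^T).
Proof.
rewrite [(_ + _)^T]linearD /= [(_ *: _)^T]linearZ /= mulmxDl !mulmxDr.
rewrite -!scalemxAl -!scalemxAr scalerA.
by rewrite /symprod scalerDr expr2 !addrA.
Qed.

Lemma Phi_sq_eDZ i j (a : C) :
  Phi ((e_ i + a *: e_ j) *m (e_ i + a *: e_ j)^T) =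
  P i + a *: H i j + a ^+ 2 *: P j.
Proof.
rewrite sq_eDZ !PhiD ?PhiZ //; repeat first [exact: symmx_sq | exact: symmx_symprod
 | apply: symmxZ | apply: symmxD].
Qed.

Lemma diag_imM i j : P i *m P j = if i == j then P i else 0.
Proof.
case: eqP => [<-|/eqP/negPf ne]; first exact/Hidem/rank1_diag.
(* [2 P j] is the image of [symprod (e_ j) (e_ j)], which brings this case under [zero_prodl]. *)
apply: (@scalerI _ _ (2 : C)); rewrite ?pnatr_eq0 // scaler0 scaler_nat mulr2n.
by rewrite -mulmxDr -offdiag_imii; apply: zero_prodl; rewrite dot_e ne.
Qed.

Lemma diag_offdiag0 i j k : k != i -> k != j -> P k *m H i j = 0.
Proof.
by move=> /negPf h /negPf h'; apply: zero_prodl; rewrite dot_e ?h ?h'.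
Qed.

(** These are the coefficients of [a] and [a ^+ 2] in a vanishing polynomial. That of [a ^+ 3] is
    the first relation with [i] and [j] exchanged, and the extreme ones vanish by [diag_imM]. *)
Lemma offdiag_rel i j : i != j ->
  [/\ P i *m H i j = H i j *m P j & H i j *m H i j = P i + P j].
Proof.
move=> ne; have /negPf nef := ne.
have [] := @cubic_coef_eq0 C _ _ (H i j *m P j - P i *m H i j)
   (P i + P j - H i j *m H i j) (H i j *m P i - P j *m H i j).
  (* The squares of [e_i + a e_j] and [e_j - a e_i] have product zero; separate
     the powers of [a]. *)
  move=> a.
  have : Phi ((e_ i + a *: e_ j) *m (e_ i + a *: e_ j)^T) *m
         Phi ((e_ j + (- a) *: e_ i) *m (e_ j + (- a) *: e_ i)^T) = 0.
    apply: Hzp; try exact: symmx_sq.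
    rewrite mulmxA -(mulmxA (_ + _)) (_ : _^T *m _ = 0) ?mulmx0 ?mul0mx //.
    rewrite [(_ + _)^T]linearD /= [(_ *: _)^T]linearZ /= mulmxDl !mulmxDr.
    rewrite -!scalemxAl -!scalemxAr !dot_e !eqxx nef eq_sym nef !scaler0.
    by rewrite add0r addr0 -scalerDl addNr scale0r.
  rewrite !Phi_sq_eDZ (offdiag_imC j i) !mulmxDl !mulmxDr.
  rewrite -!scalemxAl -!scalemxAr !diag_imM !eqxx nef eq_sym nef !scaler0 !scalerA.
  move: (P i *m H i j) (H i j *m P j) (H i j *m H i j) (H i j *m P i)
    (P j *m H i j) => x1 x2 x3 x4 x5 <-.
  by apply/matrixP=> k l; rewrite !mxE; ring.
by move=> /subr0_eq -> /subr0_eq ->.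
Qed.

(** For [M = P i + H i j + P j], idempotency of [2^-1 M] says [M^2 = 2 M], while [offdiag_rel] turns
    [M^2] into [2 (P i + P j + P i H i j + P j H i j)]. *)
Lemma offdiag_split i j : i != j -> H i j = P i *m H i j + P j *m H i j.
Proof.
move=> ne; have /negPf nef := ne.
have [PH HH] := offdiag_rel i j ne.
have PH' : P j *m H i j = H i j *m P i.
  by rewrite eq_sym in ne; have [] := offdiag_rel _ _ ne; rewrite offdiag_imC.
have := Hidem _ (rank1_offdiag i j ne).
have := Phi_sq_eDZ i j 1; rewrite expr1n !scale1r => E.
rewrite PhiZ ?E; last exact: symmx_sq.
rewrite -scalemxAl -scalemxAr.
have nz2 : (2^-1 : C) != 0 by rewrite invr_eq0 pnatr_eq0.
move/(scalerI nz2).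
rewrite !mulmxDl !mulmxDr HH -PH -PH' !diag_imM !eqxx nef eq_sym nef.
move: (P i *m _) (P j *m _) => x y /matrixP h.
apply/matrixP=> k l; have := h k l; rewrite !mxE.
move: (H i j k l) (P i k l) (P j k l) (x k l) (y k l) => a b c d e h'.
by transitivity ((b + a + c) - b - c); [ring | rewrite -h'; field].
Qed.

(** The diagonal is separate because [H i i = 2 P i], which would make [P i H i i] twice too
    large. *)
Definition munit i j := if i == j then P i else P i *m H i j.
Local Notation E := munit.

Lemma diag_munit i j : P i *m E i j = E i j.
Proof. by rewrite /E; case: eqP => _; rewrite ?mulmxA diag_imM eqxx. Qed.

Lemma munit_diag i j : E i j *m P j = E i j.
Proof.
rewrite /E; case: eqP => [->|/eqP ne]; first by rewrite diag_imM eqxx.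
by have [-> _] := offdiag_rel _ _ ne; rewrite -mulmxA diag_imM eqxx.
Qed.

Lemma munit_sum i j : H i j = E i j + E j i.
Proof.
rewrite /E eq_sym; have [->|ne] := eqVneq j i; first exact: offdiag_imii.
by rewrite (offdiag_imC j i); apply: offdiag_split; rewrite eq_sym.
Qed.

(** Distinct inner indices give the factor [P j P k = 0]. Otherwise [i = l] reduces to the square of
    [H i j], and three distinct indices call for one more orthogonality relation. *)
Lemma munitM i j k l : E i j *m E k l = if j == k then E i l else 0.
Proof.
case: eqP => [<-|/eqP/negPf ne]; last first.
  rewrite -munit_diag -(diag_munit k) mulmxA -(mulmxA _ (P j)) diag_imM ne.
  by rewrite mulmx0 mul0mx.
have [<-|nij] := eqVneq i j; first by rewrite {1}/E eqxx diag_munit.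
have [<-|njl] := eqVneq j l; first by rewrite {2}/E eqxx munit_diag.
rewrite /E (negPf nij) (negPf njl).
have [PHij HHij] := offdiag_rel _ _ nij.
have -> : P i *m H i j *m (P j *m H j l) = P i *m H i j *m H j l.
  by rewrite PHij -!mulmxA (mulmxA (P j)) diag_imM eqxx.
case: eqP => [<-|/eqP nil].
  rewrite (offdiag_imC j i) -mulmxA HHij mulmxDr !diag_imM eqxx (negPf nij).
  by rewrite addr0.
have nji : j != i by rewrite eq_sym.
(* [e_i + e_j] is orthogonal to both [e_j - e_i] and [e_l]. *)
have : Phi ((e_ i + 1 *: e_ j) *m (e_ i + 1 *: e_ j)^T) *m
    Phi (symprod (e_ j + -1 *: e_ i) (e_ l)) = 0.
  apply: zero_prodl; rewrite scale1r [(_ + _)^T]linearD /= mulmxDl.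
    rewrite !mulmxDr -!scalemxAr !dot_e !eqxx (negPf nij) (negPf nji).
    by rewrite scaler0 add0r addr0 scaleN1r addNr.
  by rewrite !dot_e (negPf nil) (negPf njl) addr0.
rewrite Phi_sq_eDZ symprodDl symprodZl PhiD ?PhiZ; try exact: symmx_symprod;
  last by apply: symmxZ; exact: symmx_symprod.
(* From [(P i + H i j + P j) (H j l - H i l) = 0], left multiplication by [P i] keeps only
   [P i H i j H j l - P i H i l]. *)
rewrite expr1n !scale1r scaleN1r -/(H j l) -/(H i l) => /(congr1 (mulmx (P i))).
rewrite mulmx0 mulmxA !mulmxDr !mulmxDl !mulmxN !diag_imM eqxx (negPf nij).
rewrite (diag_offdiag0 j l i) // !mul0mx add0r subr0 addr0.
have -> : P i *m H i j *m H i l = 0 by rewrite PHij -mulmxA diag_offdiag0 // mulmx0.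
by rewrite subr0 => /subr0_eq.
Qed.

(** [Phi] is linear on symmetric matrices only, so [A] is expanded as [2^-1 (A + A^T)] in symmetric
    products. [munit_sum] then yields two double sums, equal by the symmetry of [A]. *)
Lemma Phi_munitE A : symmx A -> Phi A = \sum_i \sum_j A i j *: E i j.
Proof.
move=> sA.
have EA : A = \sum_i \sum_j (2^-1 * A i j) *: symprod (e_ i) (e_ j).
  transitivity (2^-1 *: (A + A^T)).
    by rewrite sA -mulr2n -scaler_nat scalerA mulVf ?scale1r ?pnatr_eq0.
  rewrite {1 2}(matrix_sum_delta A) linear_sum -big_split scaler_sumr /=.
  apply: eq_bigr => i _; rewrite linear_sum -big_split scaler_sumr /=.
  apply: eq_bigr => j _; rewrite linearZ /= -scalerDr scalerA; congr (_ *: _).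
  by rewrite /symprod !trmx_delta !mul_delta_mx.
have s2 i j : symmx ((2^-1 * A i j) *: symprod (e_ i) (e_ j)).
  by apply: symmxZ; exact: symmx_symprod.
rewrite {1}EA pair_bigA /= Phi_sum //.
rewrite -(pair_bigA _ (fun i j => Phi ((2^-1 * A i j) *: symprod (e_ i) (e_ j)))) /=.
transitivity (2^-1 *: (\sum_i \sum_j A i j *: E i j + \sum_i \sum_j A i j *: E j i)).
  rewrite -big_split scaler_sumr; apply: eq_bigr => i _ /=.
  rewrite -big_split scaler_sumr; apply: eq_bigr => j _ /=.
  by rewrite PhiZ; [rewrite -/(H i j) munit_sum -scalerDr scalerA | exact: symmx_symprod].
rewrite [X in _ + X]exchange_big /=.
have -> : \sum_j \sum_i A i j *: E j i = \sum_j \sum_i A j i *: E j i.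
  by apply: eq_bigr => j _; apply: eq_bigr => i _; rewrite -{1}sA mxE.
by rewrite -mulr2n -scaler_nat scalerA mulVf ?scale1r ?pnatr_eq0.
Qed.

(** The projections of [rank1_offdiag] make [H i j] symmetric, so [P i H i j] has transpose
    [H i j P i], which is [P j H j i]. *)
Lemma tr_munit :
    (forall A : 'M[C]_n, rank1_real_sym_idem A -> (Phi A)^T = Phi A) ->
  forall i j, (E i j)^T = E j i.
Proof.
move=> Hsym i j.
have sP k : (P k)^T = P k by apply/Hsym/rank1_diag.
rewrite /E eq_sym; have [->|ne] := eqVneq j i; first exact: sP.
have sH : (H i j)^T = H i j.
  rewrite eq_sym in ne.
  have := Hsym _ (rank1_offdiag i j ne).
  have := Phi_sq_eDZ i j 1; rewrite expr1n !scale1r => Ea.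
  rewrite PhiZ ?Ea; last exact: symmx_sq.
  have nz2 : (2^-1 : C) != 0 by rewrite invr_eq0 pnatr_eq0.
  rewrite linearZ /= => /(scalerI nz2); rewrite !linearD /= !sP.
  by move=> /addIr/addrI.
by have [-> _] := offdiag_rel _ _ ne; rewrite trmx_mul sH sP offdiag_imC.
Qed.

End MatrixUnits.

(** * Reduction to block form *)

(** Only the first [k * n.+1] rows of [S] and columns of [T] are prescribed, since the others meet
    zeros of [kron_block]. The size [n.+1] provides the index [ord0]. *)
Lemma matrix_units_kron_block (C : numClosedFieldType) (n r : nat)
    (e : 'I_n.+1 -> 'I_n.+1 -> 'M[C]_r) (k : nat)
    (X : 'M[C]_(r, k)) (Y : 'M[C]_(k, r)) :
    (forall i j p q, e i j *m e p q = if j == p then e i q else 0) ->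
    e ord0 ord0 = X *m Y -> Y *m X = 1%:M ->
  exists (V : 'M[C]_(k * n.+1, r)) (W : 'M[C]_(r, k * n.+1)),
  [/\ V *m W = 1%:M,
      (Y = X^T -> (forall i j, (e i j)^T = e j i) -> V = W^T)
    & forall (le : (k * n.+1 <= r)%N) (S T : 'M[C]_r),
      rowsub (widen_ord le) S = V -> colsub (widen_ord le) T = W ->
      forall A, T *m kron_block r k A *m S = \sum_i \sum_j A i j *: e i j].
Proof.
move=> eM eXY YX.
have [V DV] : exists V : 'M[C]_(k * n.+1, r),
    forall a p j, V (block_index _ _ a p) j = (Y *m e ord0 p) a j.
  have [v Dv] := block_index_fun _ _ _ (fun a p => row a (Y *m e ord0 p)).
  by exists (\matrix_c v c) => a p j; rewrite mxE Dv mxE.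
have [W DW] : exists W : 'M[C]_(r, k * n.+1),
    forall a p i, W i (block_index _ _ a p) = (e p ord0 *m X) i a.
  have [w Dw] := block_index_fun _ _ _ (fun a p => col a (e p ord0 *m X)).
  by exists (\matrix_(i, c) w c i 0) => a p i; rewrite mxE Dw mxE.
exists V, W; split.
- apply/matrixP=> c d.
  have [a [p ->]] := block_indexP _ _ c; have [b [q ->]] := block_indexP _ _ d.
  have -> : (V *m W) (block_index _ _ a p) (block_index _ _ b q) =
            (Y *m e ord0 p *m (e q ord0 *m X)) a b.
    by rewrite !mxE; apply: eq_bigr => x _; rewrite DV DW.
  (* For [p = q] the product is [Y e_00 X = Y X Y X = 1]. *)
  rewrite mulmxA -(mulmxA Y) eM [in RHS]mxE block_index_eq andbC.
  case: eqP => _; last by rewrite mulmx0 mul0mx mxE.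
  by rewrite eXY mulmxA YX mul1mx YX mxE.
- move=> YXt etr; apply/matrixP=> c j; have [a [p ->]] := block_indexP _ _ c.
  by rewrite DV [RHS]mxE DW YXt -[e ord0 p]trmxK etr -trmx_mul mxE.
move=> le S T SV TW A.
have DS a : (block_incl C _ _ _ le a)^T *m S = \matrix_(p, j) (Y *m e ord0 p) a j.
  by apply/matrixP=> p j; rewrite block_incl_mull [RHS]mxE -DV -SV mxE.
have DT a : T *m block_incl C _ _ _ le a = \matrix_(i, p) (e p ord0 *m X) i a.
  by apply/matrixP=> i p; rewrite block_incl_mulr [RHS]mxE -DW -TW mxE.
rewrite (kron_blockE _ _ _ _ le) mulmx_sumr mulmx_suml.
apply/matrixP=> x y; rewrite !summxE.
transitivity (\sum_a \sum_q \sum_p A p q * ((e p ord0 *m X) x a * (Y *m e ord0 q) a y)).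
  apply: eq_bigr => a _; rewrite !mulmxA DT -mulmxA DS mxE.
  apply: eq_bigr => q _; rewrite !mxE mulr_suml.
  by apply: eq_bigr => p _; rewrite !mxE mulrAC mulrC.
rewrite exchange_big; transitivity (\sum_q \sum_p A p q * e p q x y).
  apply: eq_bigr => q _; rewrite exchange_big; apply: eq_bigr => p _ /=.
  rewrite -mulr_sumr; congr (_ * _).
  (* The sum over blocks is a matrix product, and [e_p0 X Y e_0q = e_p0 e_00 e_0q = e_pq]. *)
  transitivity ((e p ord0 *m X *m (Y *m e ord0 q)) x y); first by rewrite mxE.
  by rewrite mulmxA -(mulmxA _ X) -eXY !eM !eqxx.
rewrite exchange_big; apply: eq_bigr => p _ /=; rewrite summxE.
by apply: eq_bigr => q _; rewrite mxE.
Qed.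

Lemma complement_idem (C : numClosedFieldType) (r m : nat)
    (W : 'M[C]_(r, m)) (V : 'M[C]_(m, r)) : V *m W = 1%:M ->
  (1%:M - W *m V) *m (1%:M - W *m V) = 1%:M - W *m V.
Proof.
move=> VW; rewrite mulmxBr mulmx1 mulmxBl mul1mx mulmxA -(mulmxA W) VW mulmx1.
by rewrite subrr subr0.
Qed.

Lemma kron_block0 (C : numClosedFieldType) n r (A : 'M[C]_n) :
  kron_block r 0 A = 0.
Proof. by apply/matrixP=> i j; rewrite !mxE. Qed.

Theorem theorem4p10 (C : numClosedFieldType) (n r : nat)
  (Phi : 'M[C]_n -> 'M[C]_r)
  (Hlin : linear_on_sym Phi) (Hzp : zero_prod_pres Phi) :
  ((forall A : 'M[C]_n, rank1_real_sym_idem A -> Phi A *m Phi A = Phi A)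
   <->
   (exists (k : nat) (S : 'M[C]_r),
      [/\ (k * n <= r)%N, S \in unitmx &
          forall A : 'M[C]_n, symmx A ->
            Phi A = invmx S *m kron_block r k A *m S]))
  /\
  ((forall A : 'M[C]_n, rank1_real_sym_idem A ->
       (Phi A)^T = Phi A /\ Phi A *m Phi A = Phi A)
   <->
   (exists (k : nat) (S : 'M[C]_r),
      [/\ (k * n <= r)%N, S \in unitmx, invmx S = S^T &
          forall A : 'M[C]_n, symmx A ->
            Phi A = invmx S *m kron_block r k A *m S])).
Proof.
have idem k (S : 'M[C]_r) (A : 'M[C]_n) : (k * n <= r)%N -> S \in unitmx -> A *m A = A ->
    let B := invmx S *m kron_block r k A *m S in B *m B = B.
  move=> le Su AA B; rewrite /B -!mulmxA (mulmxA S) mulmxV // mul1mx.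
  by rewrite (mulmxA (kron_block _ _ _)) kron_blockM // AA.
(* For [n = 0] there is no [ord0]; there [Phi] vanishes, and [k = 0] with [S = 1] represents it. *)
case: n Phi Hlin Hzp idem => [|n] Phi Hlin Hzp idem.
  have Phi_0 A : Phi A = 0 by rewrite [A]flatmx0; apply: (Phi0 _ _ _ _ Hlin).
  have S1 : invmx 1%:M = 1%:M^T :> 'M[C]_r by rewrite invmx1 trmx1.
  have E A : Phi A = invmx 1%:M *m kron_block r 0 A *m 1%:M.
    by rewrite Phi_0 kron_block0 mulmx0 mul0mx.
  do 2!split; first by exists 0%N, 1%:M; split; rewrite ?unitmx1.
  - by move=> _ A _; rewrite Phi_0 mulmx0.
  - by exists 0%N, 1%:M; split; rewrite ?unitmx1.
  - by move=> _ A _; rewrite Phi_0 mulmx0 trmx0.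
split; split.
- move=> Hid.
  have eM := munitM _ _ _ _ Hlin Hzp Hid.
  have [k [X [Y [eXY YX]]]] := idem_split _ _ _ (eM ord0 ord0 ord0 ord0).
  have [V [W [VW _ HST]]] := matrix_units_kron_block _ _ _ _ _ _ _ eM eXY YX.
  (* Splitting [1 - W V] supplies the missing columns [Z] and rows [U]. *)
  have [s [Z [U [ZU UZ]]]] := idem_split _ _ _ (complement_idem _ _ _ _ _ VW).
  have [|le [S [T [TS SV TW _]]]] := basis_completion _ _ _ _ W Z V U VW UZ.
    by rewrite -ZU addrC subrK.
  have [Tu Su] := mulmx1_unit TS.
  have DT : invmx S = T by rewrite -[T]mulmx1 -(mulmxV Su) mulmxA TS mul1mx.
  exists k, S; split=> // A sA.
  by rewrite DT (HST le) // (Phi_munitE _ _ _ _ Hlin Hzp Hid).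
- by move=> [k [S [le Su PhiE]]] A [sA _ AA _]; rewrite PhiE //; apply: idem.
- move=> Hsid.
  have Hid A (rA : rank1_real_sym_idem A) := (Hsid A rA).2.
  have Hs A (rA : rank1_real_sym_idem A) := (Hsid A rA).1.
  have eM := munitM _ _ _ _ Hlin Hzp Hid.
  have etr := tr_munit _ _ _ _ Hlin Hzp Hid Hs.
  have [k [X [eXX XX]]] := sym_idem_split _ _ _ (etr ord0 ord0) (eM ord0 ord0 ord0 ord0).
  have [V [W [VW VWt HST]]] := matrix_units_kron_block _ _ _ _ _ _ _ eM eXX XX.
  (* Here [Y = X^T], hence [V = W^T]; the complement of [W V] is therefore symmetric and splits
     orthogonally. *)
  have {}VWt := VWt (erefl _) etr.
  have sQ : (1%:M - W *m V)^T = 1%:M - W *m V.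
    by rewrite linearB /= trmx1 trmx_mul VWt trmxK.
  have [s [Z [ZZ1 ZZ]]] := sym_idem_split _ _ _ sQ (complement_idem _ _ _ _ _ VW).
  have [|le [S [T [TS SV TW TSt]]]] := basis_completion _ _ _ _ W Z V Z^T VW ZZ.
    by rewrite -ZZ1 addrC subrK.
  have [Tu Su] := mulmx1_unit TS.
  have DT : invmx S = T by rewrite -[T]mulmx1 -(mulmxV Su) mulmxA TS mul1mx.
  exists k, S; split=> // [|A sA]; first by rewrite DT TSt.
  by rewrite DT (HST le) // (Phi_munitE _ _ _ _ Hlin Hzp Hid).
- move=> [k [S [le Su St PhiE]]] A [sA _ AA _]; rewrite PhiE //; split.
    by rewrite !trmx_mul tr_kron_block // sA St trmxK mulmxA.
  exact: idem.
Qed.
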